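(* Let $q$ be an odd prime power such that $q-1$ is squarefree, and let $m \ge 2$. Suppose that for every partition $\lambda$ of $m$, with $\ell(\lambda)$ parts, every element of the set $\{c \in \mathbb{F}_q^\times : \chi_q(c) = (-1)^{m-\ell(\lambda)}\}$ is the discriminant of the same number of polynomials in $S_{\lambda,\mathbb{F}_q}$. Then $\gcd(q-1, m(m-1)) = 2$.
   Context: For a partition $\lambda = (\lambda_1,\dots,\lambda_k)$ of $m$ (so $\ell(\lambda)=k$), a monic $f \in \mathbb{F}_q[x]$ of degree $m$ has factorization type $\lambda$ if $f = \pi_1\cdots\pi_k$ with the $\pi_i$ distinct monic irreducible polynomials and $\deg \pi_i = \lambda_i$. $S_{\lambda,\mathbb{F}_q}$ is the set of monic squarefree polynomials in $\mathbb{F}_q[x]$ of factorization type $\lambda$. $\chi_q$ is the quadratic character of $\mathbb{F}_q^\times$. For $f$ of degree $m\ge 2$ with leading coefficient $a_m$ and roots $\alpha_i$ in a splitting field, $\operatorname{disc}(f) = a_m^{2m-2}\prod_{i<j}(\alpha_i-\alpha_j)^2$. *)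

(* Defs.v *)
From HB Require Import structures.
From mathcomp Require Import all_boot all_order all_algebra all_field.
From mathcomp Require Import boolp.
Set Implicit Arguments. Unset Strict Implicit. Unset Printing Implicit Defensive.
Import Order.TTheory GRing.Theory Num.Theory.
Local Open Scope ring_scope.

Definition squarefree (n : nat) : Prop :=
  forall p : nat, prime p -> ~~ (p * p %| n)%N.

Definition is_partition (m : nat) (la : seq nat) : bool :=
  [&& sorted geq la, all (fun x => 0 < x)%N la & sumn la == m].

Section FF.
Variable F : finFieldType.

Definition monic_of (m : nat) (t : m.-tuple F) : {poly F} :=
  'X^m + \poly_(i < m) (nth 0 t i).

Definition has_fact_type (la : seq nat) (f : {poly F}) : Prop :=
  exists s : seq {poly F},
    [/\ uniq s,
        (forall p, p \in s -> p \is monic),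
        (forall p, p \in s -> irreducible_poly p),
        [seq (size p).-1 | p : {poly F} <- s] = la &
        f = \prod_(p <- s) p].

Definition Fbar : countClosedFieldType :=
  projT1 (countable_algebraic_closure F).
Definition F_to_Fbar : {rmorphism F -> Fbar} :=
  sval (projT2 (countable_algebraic_closure F)).

Definition roots_bar (f : {poly F}) : seq Fbar :=
  sval (closed_field_poly_normal (map_poly F_to_Fbar f)).

(* disc(f) = a_m^(2m-2) prod_(i<j) (alpha_i - alpha_j)^2, computed in the
   algebraic closure and pulled back to F (it lies in F). *)
Definition disc_bar (f : {poly F}) : Fbar :=
  let r := roots_bar f in
  let m := (size f).-1 in
  F_to_Fbar (lead_coef f) ^+ (2 * m - 2) *
  \prod_(i < size r) \prod_(j < size r | (i < j)%N) (r`_i - r`_j) ^+ 2.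

Definition disc (f : {poly F}) : F :=
  odflt 0 [pick c : F | F_to_Fbar c == disc_bar f].

(* quadratic character of F^x (value on 0 irrelevant; set to 0) *)
Definition chi (c : F) : int :=
  if c == 0 then 0 else if [exists x : F, x ^+ 2 == c] then 1 else -1.

Definition count_disc (m : nat) (la : seq nat) (c : F) : nat :=
  #|[set t : m.-tuple F | `[< has_fact_type la (monic_of t) >] &&
                           (disc (monic_of t) == c)]|.
End FF.

(* Main.v *)
Require Import Defs.
From HB Require Import structures.
From mathcomp Require Import all_boot all_order all_algebra all_field.
From mathcomp Require Import boolp.
From mathcomp Require Import zify ring.
Import Order.TTheory GRing.Theory Num.Theory.
Local Open Scope ring_scope.

(** Suppose an odd prime p divides both q - 1 and m (m - 1). Writing u for
    m / p or (m - 1) / p, take for the partition la the parts p 2^j, where j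
    runs over the binary digits of u, followed by a part 1 if p does not
    divide m. The parts are distinct, so the number of polynomials of type la
    is the product of the numbers N_d of monic irreducible polynomials of
    degree d in la. By Stickelberger's theorem all their discriminants lie in
    one class of the quadratic character, which has (q - 1) / 2 elements, so
    equidistribution makes p divide this product. But N_1 = q = 1 mod p, and
    expanding n N_n by inclusion-exclusion for n = p 2^j modulo p^2 shows that
    p does not divide N_n, precisely because p^2 does not divide q - 1. *)

Set Implicit Arguments.
Unset Strict Implicit.
Unset Printing Implicit Defensive.

(** * The q-power Frobenius map on the algebraic closure, with q = [#|F|] *)

Section Frobenius.
Variable F : finFieldType.

Lemma pchar_nat_card : [pchar F].-nat #|F|.
Proof.
have [p p_pr pF] := finPcharP F.
by rewrite (eq_pnat _ (pcharf_eq pF)) (card_pprimeChar pF) pnatX pnat_id.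
Qed.

(** The exponent is the cardinality of [F] rather than its characteristic, so that the fixed points
    are exactly the image of [F]. *)
Definition frob (x : Fbar F) : Fbar F := x ^+ #|F|.

Fact frob_is_zmod_morphism : zmod_morphism frob.
Proof.
move=> x y; rewrite /frob.
have pc : [pchar Fbar F].-nat #|F|.
  rewrite (eq_pnat _ (fmorph_pchar (F_to_Fbar F))); exact: pchar_nat_card.
by rewrite exprDn_pchar // exprNn_pchar.
Qed.

Fact frob_is_monoid_morphism : monoid_morphism frob.
Proof. by split=> [|x y]; rewrite /frob ?expr1n ?exprMn. Qed.

HB.instance Definition _ :=
  GRing.isZmodMorphism.Build (Fbar F) (Fbar F) frob frob_is_zmod_morphism.
HB.instance Definition _ :=
  GRing.isMonoidMorphism.Build (Fbar F) (Fbar F) frob frob_is_monoid_morphism.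

Local Notation iota := (F_to_Fbar F).
Local Notation "f ^iota" := (map_poly iota f) (at level 2, format "f ^iota").

Lemma frob_iota c : frob (iota c) = iota c.
Proof. by rewrite /frob -rmorphXn expf_card. Qed.

Lemma iter_frob n x : iter n frob x = x ^+ (#|F| ^ n).
Proof.
by elim: n => [|n IHn] /=; rewrite ?expr1 // IHn /frob -exprM expnSr.
Qed.

Lemma iter_frob_inj n : injective (iter n frob).
Proof. by elim: n => [|n IHn] x y //= /fmorph_inj /IHn. Qed.

(** X^q - X splits over [F] as the product of all X - c, so it has no root outside the image of
    [F]. *)
Lemma frob_fixedP x : frob x = x -> exists c, x = iota c.
Proof.
move=> fx; have : root ('X^#|F| - 'X)^iota x.
  by rewrite rmorphB /= map_polyXn map_polyX rootE !hornerE -/(frob x) fx subrr.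
rewrite finField_genPoly rmorph_prod /= (eq_bigr (fun c => 'X - (iota c)%:P)).
  rewrite -(big_map _ xpredT (fun z => 'X - z%:P)) root_prod_XsubC.
  by case/mapP=> c _ ->; exists c.
by move=> c _; rewrite map_polyXsubC.
Qed.

(** Galois descent, used to bring products over Frobenius orbits down to [F]. *)
Lemma frob_fixed_poly (g : {poly Fbar F}) :
  map_poly frob g = g -> exists g0, g = g0^iota.
Proof.
move=> fg; have h i : {c : F | g`_i == iota c}.
  apply: sigW; have [|c ->] := @frob_fixedP g`_i; last by exists c.
  by rewrite -{2}fg coef_map.
exists (\poly_(i < size g) sval (h i)).
apply/polyP=> i; rewrite coef_map coef_poly.
case: ltnP => [_|]; first exact/eqP/(svalP (h i)).
by move=> sg; rewrite /= rmorph0 nth_default.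
Qed.

Lemma root_frob (f : {poly F}) x : root f^iota x -> root f^iota (frob x).
Proof.
rewrite !rootE => /eqP fx; have -> : f^iota.[frob x] = frob f^iota.[x].
  rewrite -horner_map /= -map_poly_comp /=; congr _.[_].
  by apply: eq_map_poly => c /=; rewrite frob_iota.
by rewrite fx rmorph0.
Qed.

Lemma root_iter_frob (f : {poly F}) n x :
  root f^iota x -> root f^iota (iter n frob x).
Proof. by move=> fx; elim: n => //= n; apply: root_frob. Qed.

(* Pigeonhole on the residues of the powers X^(q^i) modulo g. *)
Lemma frob_periodic {g : {poly F}} {x} : g != 0 -> root g^iota x ->
  exists2 n, (0 < n)%N & iter n frob x = x.
Proof.
move=> gn0 gx; pose d := size g.
pose res i : {poly F} := 'X^(#|F| ^ i) %% g.
have [i [j [lt_ij eq_ij]]] : exists i j, (i < j)%N /\ res i = res j.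
  pose f i : d.-tuple F := [tuple (res i)`_k | k < d].
  have /injectivePn[i [j nij fij]] :
      ~~ injectiveb (fun i : 'I_#|{: d.-tuple F}|.+1 => f i).
    by apply/negP=> /injectiveP/leq_card; rewrite card_ord ltnn.
  have rij : res i = res j.
    apply/polyP=> k; have [lt_kd|le_dk] := ltnP k d; last first.
      by rewrite !nth_default // (leq_trans _ le_dk) // ltnW // ?ltn_modp.
    have /(congr1 (fun t : d.-tuple F => tnth t (Ordinal lt_kd))) := fij.
    by rewrite !tnth_mktuple.
  have [lt_ij|lt_ji|/val_inj eq_ij] := ltngtP i j.
  - by exists i, j.
  - by exists j, i.
  - by rewrite eq_ij eqxx in nij.
have ev k : iter k frob x = (res k)^iota.[x].
  rewrite iter_frob; transitivity ('X^(#|F| ^ k) : {poly F})^iota.[x].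
    by rewrite map_polyXn !hornerE.
  rewrite {1}(divp_eq 'X^(#|F| ^ k) g) rmorphD rmorphM /= hornerD hornerM.
  by rewrite (eqP gx) mulr0 add0r.
exists (j - i)%N; first by rewrite subn_gt0.
apply: (@iter_frob_inj i); rewrite -iterD subnKC 1?ltnW //.
by rewrite !ev eq_ij.
Qed.

(** * Frobenius orbits and irreducible polynomials *)

Definition exact_period n x := (iter n frob x == x) && uniq (traject frob x n).

Lemma map_frob_orbit n x : iter n frob x = x ->
  map frob (traject frob x n) = rot 1 (traject frob x n).
Proof.
have -> : map frob (traject frob x n) = traject frob (frob x) n.
  by elim: n x => //= n IHn x; rewrite IHn.
by case: n => // n fx; rewrite trajectSr -iterSr fx /= rot1_cons.
Qed.

(** Frobenius permutes the linear factors cyclically, hence fixes every coefficient of their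
    product. *)
Lemma orbit_poly n x : iter n frob x = x ->
  exists g0 : {poly F}, g0^iota = \prod_(z <- traject frob x n) ('X - z%:P).
Proof.
move=> fx.
have [|g0 ->] := @frob_fixed_poly (\prod_(z <- traject frob x n) ('X - z%:P)).
  rewrite rmorph_prod; under eq_bigr do rewrite /= map_polyXsubC.
  rewrite -(big_map _ xpredT (fun z => 'X - z%:P)) map_frob_orbit //.
  by apply: perm_big; rewrite perm_rot.
by exists g0.
Qed.

Lemma prod_XsubC_dvdp (f : {poly Fbar F}) (s : seq (Fbar F)) : uniq s ->
  all (root f) s -> \prod_(z <- s) ('X - z%:P) %| f.
Proof. by move=> us rs; apply: uniq_roots_dvdp; rewrite // uniq_rootsE. Qed.

Lemma monic_iota (f : {poly F}) : (f^iota \is monic) = (f \is monic).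
Proof. exact: map_monic. Qed.

(** A repetition among the first n iterates cancels, by injectivity of Frobenius, to a return of [x]
    to itself before step n. *)
Lemma exact_periodP n x : (0 < n)%N ->
  reflect (iter n frob x = x /\ forall a, (0 < a < n)%N -> iter a frob x <> x)
          (exact_period n x).
Proof.
move=> n_gt0; apply: (iffP andP) => [[/eqP fx ut]|[fx min]]; split=> //.
- move=> a /andP[a_gt0 lt_an] fa.
  have := nth_uniq x _ _ ut; rewrite !size_traject.
  move=> /(_ a 0%N lt_an n_gt0); rewrite !nth_traject //= fa eqxx.
  by case: a a_gt0 {lt_an fa}.
- exact/eqP.
- apply/negPn/negP=> /(uniqPn x)[i [j [lt_ij]]]; rewrite size_traject => lt_jn.
  rewrite !nth_traject ?(ltn_trans lt_ij) // => eq_ij.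
  apply: (min (j - i)%N).
    by rewrite subn_gt0 lt_ij (leq_ltn_trans (leq_subr _ _)).
  by apply: (@iter_frob_inj i); rewrite -iterD subnKC 1?ltnW.
Qed.

(** With a the least period of [x], the orbit polynomial descends to [g0] over [F]. Its distinct
    roots are all roots of [g], so [g0] divides [g]; sharing the root [x] with the irreducible [g],
    it is also a multiple of [g]. *)
Lemma irreducible_orbit {g : {poly F}} {x} :
    g \is monic -> irreducible_poly g -> root g^iota x ->
  exact_period (size g).-1 x /\
  g^iota = \prod_(z <- traject frob x (size g).-1) ('X - z%:P).
Proof.
move=> mon irr gx.
have [n n_gt0 fn] := frob_periodic (monic_neq0 mon) gx.
have ex : exists n, (0 < n)%N && (iter n frob x == x).
  by exists n; rewrite n_gt0 fn eqxx.
case: (ex_minnP ex) => a /andP[a_gt0 /eqP fa] min {n n_gt0 fn ex}.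
have exa : exact_period a x.
  apply/exact_periodP=> //; split=> // b /andP[b_gt0 lt_ba] fb.
  by have := min b; rewrite b_gt0 fb eqxx leqNgt lt_ba => /(_ isT).
have [g0 g0E] := orbit_poly fa.
have g0mon : g0 \is monic by rewrite -monic_iota g0E monic_prod_XsubC.
have gE : g^iota = \prod_(z <- traject frob x a) ('X - z%:P).
  rewrite -g0E; congr (_^iota); apply/eqP; rewrite -eqp_monic // /eqp.
  apply/andP; split; last first.
    rewrite -(dvdp_map iota) g0E; apply: prod_XsubC_dvdp; first by case/andP: exa.
    by apply/allP=> _ /trajectP[i _ ->]; apply: root_iter_frob.
  apply/negPn; rewrite -irreducible_poly_coprime //.
  rewrite -(coprimep_map iota); apply/negP=> /coprimep_root/(_ gx)/eqP; apply.
  apply/eqP; rewrite -rootE g0E root_prod_XsubC.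
  by case: a a_gt0 {fa min exa g0E} => // a _; rewrite inE eqxx.
have -> : (size g).-1 = a.
  by rewrite -(size_map_poly iota) gE size_prod_XsubC size_traject.
by [].
Qed.

Lemma orbit_irreducible n x : (0 < n)%N -> exact_period n x ->
  exists g : {poly F}, [/\ g \is monic, irreducible_poly g,
    size g = n.+1 & root g^iota x].
Proof.
move=> n_gt0 exn; have /andP[/eqP fx ut] := exn.
have [g0 g0E] := orbit_poly fx.
have sg0 : size g0 = n.+1.
  by rewrite -(size_map_poly iota) g0E size_prod_XsubC size_traject.
exists g0; split=> //; first by rewrite -monic_iota g0E monic_prod_XsubC.
  split; first by rewrite sg0.
  move=> h sh hg; rewrite /eqp hg /=.
  have : size h^iota != 1%N by rewrite size_map_poly.
  case/closed_rootP=> y hy.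
  have : root g0^iota y.
    by apply: root_dvdp hy; rewrite dvdp_map.
  rewrite g0E root_prod_XsubC => /trajectP[i lt_in yE].
  (* Going once around the cycle, n - i further steps take y back to [x]; so a factor with one root
     in the orbit has them all. *)
  have hx : root h^iota x.
    by rewrite -fx -(subnK (ltnW lt_in)) iterD -yE; apply: root_iter_frob.
  rewrite -(dvdp_map iota) g0E; apply: prod_XsubC_dvdp => //.
  by apply/allP=> _ /trajectP[j _ ->]; apply: root_iter_frob.
rewrite g0E root_prod_XsubC; case: n n_gt0 {exn fx ut g0E sg0} => // n _.
by rewrite inE eqxx.
Qed.

Lemma roots_bar_monic (f : {poly F}) : f \is monic ->
  f^iota = \prod_(z <- roots_bar f) ('X - z%:P).
Proof.
move=> fm; rewrite /roots_bar; case: closed_field_poly_normal => r /= {1}->.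
by rewrite lead_coef_map (eqP fm) rmorph1 scale1r.
Qed.

Definition monic_irreducible (g : {poly F}) :=
  g \is monic /\ irreducible_poly g.

(** For irreducible [g], the roots in Frobenius order from an arbitrary root: in this order
    Frobenius acts as a rotation of the list. *)
Definition orbit_bar (g : {poly F}) : seq (Fbar F) :=
  traject frob (head 0 (roots_bar g)) (size g).-1.

Lemma orbit_barP g : monic_irreducible g ->
  exact_period (size g).-1 (head 0 (roots_bar g)) /\
  g^iota = \prod_(z <- orbit_bar g) ('X - z%:P).
Proof.
move=> [mon irr]; apply: irreducible_orbit => //.
have := roots_bar_monic mon; have [sg _] := irr.
case: (roots_bar g) => [|x r] gE; last first.
  by rewrite gE root_prod_XsubC mem_head.
by move: sg; rewrite -(size_map_poly iota) gE big_nil size_poly1.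
Qed.

Lemma mem_orbit_bar g x : monic_irreducible g ->
  (x \in orbit_bar g) = root g^iota x.
Proof. by move=> /orbit_barP[_ ->]; rewrite root_prod_XsubC. Qed.

Lemma monic_irreducible_root_eq {g h x} :
    monic_irreducible g -> monic_irreducible h ->
  root g^iota x -> root h^iota x -> g = h.
Proof.
move=> [gm gi] [hm hi] gx hx; apply/eqP; rewrite -eqp_monic //.
apply: apply_irredp => //; first by have [sg _] := gi; rewrite gtn_eqF.
apply/negPn; rewrite -irreducible_poly_coprime // -(coprimep_map iota).
by apply/negP=> /coprimep_root/(_ gx)/eqP; apply; apply/eqP.
Qed.

Lemma uniq_flatten_orbit_bar s : uniq s ->
    (forall g, g \in s -> monic_irreducible g) ->
  uniq (flatten [seq orbit_bar g | g <- s]).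
Proof.
elim: s => //= g s IHs /andP[gs us] irr.
have irs (h : {poly F}) : h \in s -> monic_irreducible h.
  by move=> hs; apply: (irr h); rewrite inE hs orbT.
have irg := irr g (mem_head _ _).
rewrite cat_uniq IHs // andbT; have [/andP[_ ->] _] := orbit_barP irg.
apply/hasPn=> x /flattenP[_ /mapP[h hs ->]].
rewrite (mem_orbit_bar _ (irs _ hs)) => hx.
rewrite mem_orbit_bar //; apply: contraNN gs => gx.
by rewrite (monic_irreducible_root_eq irg (irs _ hs) gx hx).
Qed.

Lemma size_monic_of n (t : n.-tuple F) : size (monic_of t) = n.+1.
Proof.
by rewrite size_polyDl size_polyXn // ltnS size_poly.
Qed.

Lemma monic_of_monic n (t : n.-tuple F) : monic_of t \is monic.
Proof.
by rewrite monicE lead_coefDl ?size_polyXn ?ltnS ?size_poly // lead_coefXn.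
Qed.

Lemma monic_of_inj n : injective (@monic_of F n).
Proof.
move=> t u /addrI/polyP tu; apply/eq_from_tnth => i.
by have := tu i; rewrite !coef_poly ltn_ord !(tnth_nth 0).
Qed.

Lemma monic_of_surj n (g : {poly F}) : g \is monic -> (size g).-1 = n ->
  exists t : n.-tuple F, monic_of t = g.
Proof.
move=> gm gn; have sg : size g = n.+1.
  by rewrite -gn prednK // lt0n size_poly_eq0 monic_neq0.
exists [tuple g`_i | i < n]; apply/polyP=> i.
rewrite coefD coefXn coef_poly; case: ltngtP => // [lt_in|lt_ni|->].
- by rewrite add0r -(tnth_nth 0 _ (Ordinal lt_in)) tnth_mktuple.
- by rewrite addr0 nth_default // sg.
- by move/eqP: gm; rewrite addr0 lead_coefE sg.
Qed.

(** * Enumeration of the monic irreducible polynomials of a given degree *)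

Definition Irr n : seq {poly F} :=
  [seq g <- [seq monic_of t | t : n.-tuple F] | `[< irreducible_poly g >]].

Lemma Irr_uniq n : uniq (Irr n).
Proof.
by rewrite filter_uniq // map_inj_uniq ?enum_uniq //; apply: monic_of_inj.
Qed.

Lemma mem_Irr n g : (g \in Irr n) <-> monic_irreducible g /\ (size g).-1 = n.
Proof.
rewrite mem_filter; split.
  move=> /andP[/asboolP irr /mapP[t _ gE]].
  by rewrite /monic_irreducible gE size_monic_of monic_of_monic -gE.
move=> [[gm gi] /(monic_of_surj gm)[t tg]].
apply/andP; split; first exact/asboolP.
by rewrite -tg map_f ?mem_enum.
Qed.

(** * Periodic points of Frobenius *)

Lemma card_expn_gt1 n : (0 < n)%N -> (1 < #|F| ^ n)%N.
Proof. by move=> n_gt0; rewrite -(exp1n n) ltn_exp2r ?finNzRing_gt1. Qed.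

(** For n > 0, the subfield of [Fbar F] with q^n elements. *)
Definition periodic_bar n : seq (Fbar F) :=
  sval (closed_field_poly_normal ('X^(#|F| ^ n) - 'X)).

Lemma size_oppX_lt n : (0 < n)%N ->
  (size (- 'X : {poly Fbar F}) < size ('X^(#|F| ^ n) : {poly Fbar F}))%N.
Proof.
by move=> n_gt0; rewrite size_polyXn size_polyN size_polyX ltnS card_expn_gt1.
Qed.

Lemma periodic_bar_prod n : (0 < n)%N ->
  'X^(#|F| ^ n) - 'X = \prod_(z <- periodic_bar n) ('X - z%:P) :> {poly Fbar F}.
Proof.
move=> n_gt0; rewrite /periodic_bar; case: closed_field_poly_normal => r /= {1}->.
by rewrite lead_coefDl ?lead_coefXn ?scale1r // size_oppX_lt.
Qed.

Lemma size_periodic_bar n : (0 < n)%N -> size (periodic_bar n) = (#|F| ^ n)%N.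
Proof.
move=> n_gt0.
have := congr1 (fun f : {poly _} => size f) (periodic_bar_prod n_gt0).
by rewrite size_prod_XsubC size_polyDl ?size_oppX_lt // size_polyXn => [[]].
Qed.

Lemma mem_periodic_bar n x : (0 < n)%N ->
  (x \in periodic_bar n) = (iter n frob x == x).
Proof.
move=> n_gt0; rewrite -root_prod_XsubC -periodic_bar_prod // rootE !hornerE.
by rewrite iter_frob subr_eq0.
Qed.

Lemma card_natr_eq0 : #|F|%:R = 0 :> F.
Proof.
have [p p_pr pF] := finPcharP F; apply/eqP; rewrite -(dvdn_pcharf pF).
have := pchar_nat_card; rewrite (eq_pnat _ (pcharf_eq pF)).
move=> /p_natP[[|k] qE]; last by rewrite qE expnS dvdn_mulr.
by have := finNzRing_gt1 F; rewrite qE.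
Qed.

(** The derivative of X^(q^n) - X is the constant -1, since q vanishes in [F]; so this polynomial is
    separable. *)
Lemma uniq_periodic_bar n : (0 < n)%N -> uniq (periodic_bar n).
Proof.
move=> n_gt0; rewrite -separable_prod_XsubC -periodic_bar_prod // unlock.
rewrite derivB derivXn derivX.
have -> : 'X^((#|F| ^ n).-1) *+ (#|F| ^ n) = 0 :> {poly Fbar F}.
  case: n n_gt0 => // n _; rewrite expnS mulrnA -(mulr_natl _ #|F|) -polyC_natr.
  by rewrite -(rmorph_nat iota) card_natr_eq0 rmorph0 mul0r mul0rn.
by rewrite sub0r -(scaleN1r 1) coprimepZr ?oppr_eq0 ?oner_eq0 // coprimep1.
Qed.

(* Each monic irreducible polynomial of degree n corresponds to a Frobenius
   orbit of n distinct points. *)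
Lemma count_exact_period n : (0 < n)%N ->
  count (exact_period n) (periodic_bar n) = (n * size (Irr n))%N.
Proof.
move=> n_gt0; rewrite -size_filter.
have irr g : g \in Irr n -> monic_irreducible g by case/mem_Irr.
rewrite (@perm_size _ _ (flatten [seq orbit_bar g | g <- Irr n])).
  rewrite size_flatten /shape -map_comp sumnE big_map.
  rewrite big_seq (eq_bigr (fun=> n)) -?big_seq ?big_const_seq ?count_predT.
    by rewrite iter_addn_0.
  by move=> g /mem_Irr[_ gn]; rewrite /= size_traject.
apply: uniq_perm.
- by rewrite filter_uniq ?uniq_periodic_bar.
- exact: uniq_flatten_orbit_bar (Irr_uniq n) irr.
move=> x; rewrite mem_filter mem_periodic_bar //; apply/andP/flattenP.
  move=> [exn _]; have [g [gm gi gn gx]] := orbit_irreducible n_gt0 exn.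
  exists (orbit_bar g); last by rewrite mem_orbit_bar.
  by apply/map_f/mem_Irr; rewrite gn.
move=> [_ /mapP[g gI ->]]; have [gmi gn] := (mem_Irr _ _).1 gI.
rewrite mem_orbit_bar // => gx; have [gm gi] := gmi.
by have [] := irreducible_orbit gm gi gx; rewrite gn => exn; have /andP[] := exn.
Qed.

Lemma iter_frob_gcdn a b x : iter a frob x = x -> iter b frob x = x ->
  iter (gcdn a b) frob x = x.
Proof.
case: a => [|a] fa fb; first by rewrite gcd0n.
have [u v e _] := egcdnP b (ltn0Sn a).
have := iter_fix u fa; rewrite -iterM e addnC iterD.
by rewrite iterM (iter_fix v fb).
Qed.

(** Testing the maximal proper divisors of n suffices: a return after a < n steps yields one after g
    = gcd(n, a) steps, and g divides n / l for any prime l dividing n / g. *)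
Lemma exact_period_primeP n x : (0 < n)%N ->
  reflect (iter n frob x = x /\
           forall l, prime l -> (l %| n)%N -> iter (n %/ l) frob x <> x)
          (exact_period n x).
Proof.
move=> n_gt0; apply: (iffP (exact_periodP x n_gt0)) => [] [fx min]; split=> //.
  move=> l l_pr ln; apply: min.
  by rewrite divn_gt0 ?prime_gt0 // dvdn_leq // ltn_Pdiv ?prime_gt1.
move=> a /andP[a_gt0 lt_an] fa.
have fg := iter_frob_gcdn fx fa; set g := gcdn n a in fg.
have g_n : (g %| n)%N by apply: dvdn_gcdl.
have g_gt0 : (0 < g)%N by rewrite gcdn_gt0 n_gt0.
have lt_gn : (g < n)%N.
  by apply: leq_ltn_trans lt_an; rewrite dvdn_leq ?dvdn_gcdr.
have ng1 : (1 < n %/ g)%N by rewrite ltn_divRL // mul1n.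
have l_pr := pdiv_prime ng1; set l := pdiv _ in l_pr.
have l_ng : (l %| n %/ g)%N := pdiv_dvd _.
have l_n : (l %| n)%N by apply: dvdn_trans l_ng (dvdn_div g_n).
apply: (min l l_pr l_n).
have -> : (n %/ l = (n %/ g %/ l) * g)%N.
  by rewrite divn_mulAC // divnK.
by rewrite iterM; apply: iter_fix.
Qed.

End Frobenius.

Arguments frob {F} x.

(** * Counting irreducible polynomials modulo p^2 *)

Lemma expn_affine_mod p k a :
  exists c, ((1 + p * k) ^ a = 1 + a * p * k + p * p * c)%N.
Proof.
elim: a => [|a [c IHa]]; first by exists 0%N; lia.
exists (c * (1 + p * k) + a * k * k)%N.
by rewrite expnS IHa; lia.
Qed.

Section CountIrreducible.
Variable F : finFieldType.

Lemma count_fixed a n : (0 < n)%N -> (a %| n)%N ->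
  count (fun x : Fbar F => iter a frob x == x) (periodic_bar F n) = (#|F| ^ a)%N.
Proof.
move=> n_gt0 an; have a_gt0 : (0 < a)%N := dvdn_gt0 n_gt0 an.
rewrite -size_filter -(size_periodic_bar F a_gt0); apply: perm_size.
apply: uniq_perm => [||x]; rewrite ?filter_uniq ?uniq_periodic_bar //.
rewrite mem_filter !mem_periodic_bar //; apply: andb_idr => /eqP fx.
by have /dvdnP[k ->] := an; rewrite iterM iter_fix.
Qed.

Lemma size_Irr1 : size (Irr F 1) = #|F|.
Proof.
rewrite -[LHS]mul1n -count_exact_period // -[RHS]expn1 -(@count_fixed 1 1) //.
by apply: eq_count => x; rewrite /exact_period /= andbT.
Qed.

(** A point of the field with q^p elements has exact period p unless it lies in [F]. *)
Lemma size_Irr_prime p : prime p ->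
  (p * size (Irr F p) + #|F| = #|F| ^ p)%N.
Proof.
move=> p_pr; have p_gt0 := prime_gt0 p_pr.
rewrite -count_exact_period // -{1}(expn1 #|F|) -(@count_fixed 1 p) //.
rewrite -(size_periodic_bar F p_gt0) -(count_predC (fun x => iter 1 frob x == x)).
rewrite addnC; congr addn; apply: eq_in_count => x.
rewrite mem_periodic_bar // => /eqP fx /=.
apply/exact_period_primeP/idP => // [[_ /(_ p p_pr (dvdnn p))]|nf].
  by rewrite divnn p_gt0 => /eqP.
split=> // l l_pr; rewrite dvdn_prime2 // => /eqP ->.
by rewrite divnn p_gt0; apply/eqP.
Qed.

(** Inclusion-exclusion over the two maximal proper divisors 2^(i+1) and p 2^i of n, whose gcd is
    2^i. The terms are arranged to avoid truncated subtraction. *)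
Lemma size_Irr_prime_pow2 p i : prime p -> p != 2%N ->
  (p * 2 ^ i.+1 * size (Irr F (p * 2 ^ i.+1)) + #|F| ^ (2 ^ i.+1)
     + #|F| ^ (p * 2 ^ i) = #|F| ^ (p * 2 ^ i.+1) + #|F| ^ (2 ^ i))%N.
Proof.
move=> p_pr p2; have p_gt0 := prime_gt0 p_pr; set n := (p * 2 ^ i.+1)%N.
have n_gt0 : (0 < n)%N by rewrite muln_gt0 p_gt0 expn_gt0.
have np : (n %/ p = 2 ^ i.+1)%N by rewrite mulKn.
have n2 : (n %/ 2 = p * 2 ^ i)%N by rewrite /n expnSr mulnA mulnK.
pose fixed a := fun x : Fbar F => iter a frob x == x.
have dv1 : (2 ^ i.+1 %| n)%N by rewrite dvdn_mull.
have dv2 : (p * 2 ^ i %| n)%N.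
  by rewrite -n2 dvdn_div // /n expnS mulnCA dvdn_mulr.
have dv3 : (2 ^ i %| n)%N by apply: dvdn_trans dv1; rewrite expnS dvdn_mull.
rewrite -count_exact_period // -(count_fixed n_gt0 dv1) -(count_fixed n_gt0 dv2).
rewrite -(count_fixed n_gt0 dv3) -(size_periodic_bar F n_gt0) -addnA.
pose U := predU (fixed (2 ^ i.+1)%N) (fixed (p * 2 ^ i)%N).
pose I := predI (fixed (2 ^ i.+1)%N) (fixed (p * 2 ^ i)%N).
have eI : count I (periodic_bar F n) = count (fixed (2 ^ i)%N) (periodic_bar F n).
  apply: eq_count => x; apply/andP/eqP => [[/eqP fa /eqP fb]|fx].
    have cop : coprime 2 p by rewrite prime_coprime // dvdn_prime2 // eq_sym.
    have := iter_frob_gcdn fa fb.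
    by rewrite expnS -muln_gcdl (eqP cop) mul1n.
  by rewrite /fixed expnS !iterM !(iter_fix _ fx) eqxx.
have eX : count (exact_period n) (periodic_bar F n) = count (predC U) (periodic_bar F n).
  apply: eq_in_count => x; rewrite mem_periodic_bar // => /eqP fx.
  rewrite /= negb_or; apply/exact_period_primeP/andP => // [[_ min]|[/eqP n1 /eqP n0]].
    split; apply/eqP; first by rewrite -np; apply: min; rewrite // dvdn_mulr.
    by rewrite -n2; apply: min; rewrite // /n expnS mulnCA dvdn_mulr.
  split=> // l l_pr; rewrite Euclid_dvdM // Euclid_dvdX //.
  by rewrite !dvdn_prime2 // => /orP[/eqP ->|/andP[/eqP -> _]]; rewrite ?np ?n2.
have := count_predUI (fixed (2 ^ i.+1)%N) (fixed (p * 2 ^ i)%N) (periodic_bar F n).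
have := count_predC U (periodic_bar F n).
rewrite -/U -/I eI eX -/(fixed _) => <- UI.
by rewrite -UI [RHS]addnAC addnC.
Qed.

Lemma size_Irr_coprime p j : prime p -> p != 2%N -> (p %| #|F|.-1)%N ->
  ~~ (p * p %| #|F|.-1)%N -> ~~ (p %| size (Irr F (p * 2 ^ j)))%N.
Proof.
move=> p_pr p2 /dvdnP[k qk] npp; have p_gt0 := prime_gt0 p_pr.
have nk : ~~ (p %| k)%N by apply: contra npp; rewrite qk dvdn_pmul2r.
have qE : #|F| = (1 + p * k)%N.
  by rewrite mulnC -qk add1n prednK // ltnW ?finNzRing_gt1.
have [j0|[i ji]] : j = 0%N \/ exists i, j = i.+1.
  by case: j => [|i]; [left|right; exists i].
  rewrite j0 muln1; apply: contra nk => pN.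
  have := size_Irr_prime p_pr; rewrite qE; set N := size _ in pN *.
  have [c ->] := expn_affine_mod p k p => e.
  (* Degree p: q^p = 1 modulo p^2, so p (N + k) = 0 modulo p^2. *)
  have /eqP : (p * (N + k) = p * (p * k + p * c))%N by lia.
  rewrite eqn_pmul2l // => /eqP e'.
  by rewrite -(dvdn_addr k pN) e' -mulnDr dvdn_mulr.
rewrite ji; apply: contra nk => pN.
have := size_Irr_prime_pow2 i p_pr p2; rewrite qE; set N := size _ in pN *.
have [c1 ->] := expn_affine_mod p k (2 ^ i.+1).
have [c2 ->] := expn_affine_mod p k (p * 2 ^ i).
have [c3 ->] := expn_affine_mod p k (p * 2 ^ i.+1).
have [c4 ->] := expn_affine_mod p k (2 ^ i).
rewrite expnS; set t := (2 ^ i)%N => e.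
(* The constant terms cancel and one factor p divides out, leaving 2 t N + t k = 0 modulo p. As t is
   a power of 2 and p is odd, p dividing N would give p dividing k. *)
have /eqP : (p * (2 * t * N + (t * k + p * (c1 + t * k + c2)))
             = p * (p * (2 * t * k + c3 + c4)))%N by lia.
rewrite eqn_pmul2l // => /eqP e'.
have : (p %| 2 * t * N + (t * k + p * (c1 + t * k + c2)))%N.
  by rewrite e' dvdn_mulr.
rewrite (dvdn_addr _ (dvdn_mull _ pN)) (dvdn_addl _ (dvdn_mulr _ (dvdnn p))).
rewrite Euclid_dvdM // Euclid_dvdX // dvdn_prime2 //.
by rewrite (negPf p2).
Qed.

End CountIrreducible.

(** * Polynomials whose irreducible factors have prescribed distinct degrees *)

Section FactorizationTypes.
Variable F : finFieldType.
Local Notation "f ^iota" := (map_poly (F_to_Fbar F) f)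
  (at level 2, format "f ^iota").

(** Meant for distinct degrees: a repeated degree could bring in squares and repeated entries. *)
Definition polys_of_type (la : seq nat) : seq {poly F} :=
  foldr (fun d s => [seq g * h | g <- Irr F d, h <- s]) [:: 1] la.

Lemma size_polys_of_type la :
  size (polys_of_type la) = (\prod_(d <- la) size (Irr F d))%N.
Proof.
elim: la => [|d la IHla]; first by rewrite big_nil.
by rewrite big_cons /= size_allpairs IHla.
Qed.

Lemma polys_of_typeP la f : uniq la ->
  f \in polys_of_type la <-> has_fact_type la f.
Proof.
elim: la f => [|d la IHla] f /=.
  move=> _; rewrite inE; split=> [/eqP ->|[[|g s] [_ _ _ // _ ->]]].
    by exists [::]; rewrite big_nil.
  by rewrite big_nil.
move=> /andP[dla ula]; split.
  move=> /allpairsP[[g h] /= [/mem_Irr[[gm gi] gd] /IHla]].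
  move=> /(_ ula)[s [us sm si sla ->]] ->.
  exists (g :: s); rewrite /= us gd sla big_cons andbT; split=> //.
  - by apply: contraNN dla => gs; rewrite -sla -gd; apply/mapP; exists g.
  - by move=> p; rewrite inE => /orP[/eqP ->|/sm].
  - by move=> p; rewrite inE => /orP[/eqP ->|/si].
move=> [[|g s] [// /= /andP[_ us] sm si [gd sla] ->]].
rewrite big_cons; apply: allpairs_f.
  apply/mem_Irr; split=> //.
  by split; [apply: sm|apply: si]; rewrite mem_head.
apply/IHla => //; exists s; split=> // p ps.
  by apply: sm; rewrite inE ps orbT.
by apply: si; rewrite inE ps orbT.
Qed.

Lemma root_prod_seq (s : seq {poly F}) (x : Fbar F) :
  root (\prod_(g <- s) g)^iota x -> exists2 g, g \in s & root g^iota x.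
Proof.
elim: s => [|g s IHs]; first by rewrite big_nil rmorph1 rootE hornerC oner_eq0.
rewrite big_cons rmorphM rootM => /orP[gx|/IHs[h hs hx]].
  by exists g; rewrite ?mem_head.
by exists h; rewrite // inE hs orbT.
Qed.

(** A root of the first factor of degree d is a root of the other product. Either it identifies the
    two first factors, which then cancel, or it yields a factor of degree d among the remaining
    ones, although d does not occur in [la]. *)
Lemma uniq_polys_of_type la : uniq la -> uniq (polys_of_type la).
Proof.
elim: la => //= d la IHla /andP[dla ula].
apply: allpairs_uniq; [exact: Irr_uniq|exact: IHla|].
move=> [g h] [g' h'] /allpairsP[[g1 h1] /= [gI hI [-> ->]]].
move=> /allpairsP[[g2 h2] /= [gI' hI' [-> ->]]] gh.
have [gmi gd] := (mem_Irr _ _).1 gI; have [gmi' gd'] := (mem_Irr _ _).1 gI'.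
have : size g1^iota != 1%N.
  by have [_ [sg _]] := gmi; rewrite size_map_poly gtn_eqF.
case/closed_rootP=> x gx.
have : root (g2 * h2)^iota x by rewrite -gh rmorphM rootM gx.
rewrite rmorphM rootM => /orP[gx'|].
  have eg := monic_irreducible_root_eq gmi gmi' gx gx'.
  move: gh; rewrite eg => /mulfI -> //.
  by apply: monic_neq0; case: gmi'.
have /(polys_of_typeP _ ula)[s [_ sm si sla ->]] := hI'.
move=> /root_prod_seq[k ks kx].
have kg := monic_irreducible_root_eq gmi (conj (sm _ ks) (si _ ks)) gx kx.
by case/negP: dla; rewrite -sla -gd kg; apply/mapP; exists k.
Qed.

End FactorizationTypes.

(** * Vandermonde products of lists *)

Fixpoint vdm (R : nzRingType) (s : seq R) : R :=
  if s is x :: s' then \prod_(y <- s') (x - y) * vdm s' else 1.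

Lemma vdm_cat (R : comNzRingType) (s t : seq R) :
  vdm (s ++ t) = vdm s * vdm t * \prod_(x <- s) \prod_(y <- t) (x - y).
Proof.
elim: s => [|x s IHs] /=; first by rewrite big_nil mul1r mulr1.
by rewrite big_cat big_cons IHs /=; ring.
Qed.

Lemma rmorph_vdm (R S : nzRingType) (f : {rmorphism R -> S}) s :
  f (vdm s) = vdm (map f s).
Proof.
elim: s => [|x s IHs] /=; first by rewrite rmorph1.
rewrite rmorphM IHs rmorph_prod big_map; congr (_ * _).
by apply: eq_bigr => y _; rewrite rmorphB.
Qed.

Lemma prod_subC (R : comNzRingType) (s : seq R) x :
  \prod_(y <- s) (y - x) = (-1) ^+ size s * \prod_(y <- s) (x - y).
Proof.
elim: s => [|y s IHs]; first by rewrite !big_nil mulr1.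
by rewrite !big_cons IHs /= exprS; ring.
Qed.

(** Moving the head to the end reverses the sign of its differences with all other entries; the
    factor is the signature of a cycle. *)
Lemma vdm_rot1 (R : comNzRingType) (s : seq R) :
  vdm (rot 1 s) = (-1) ^+ (size s).-1 * vdm s.
Proof.
case: s => [|x s]; first by rewrite mul1r.
rewrite rot1_cons -cats1 vdm_cat /= big_nil !mulr1 mulrC mulrA; congr (_ * _).
by rewrite -prod_subC; apply: eq_bigr => y _; rewrite big_seq1.
Qed.

Lemma vdm_neq0 (R : idomainType) (s : seq R) : uniq s -> vdm s != 0.
Proof.
elim: s => [|x s IHs] /=; first by rewrite oner_eq0.
move=> /andP[xs us]; rewrite mulf_neq0 ?IHs //.
rewrite prodf_seq_neq0; apply/allP=> y ys /=; rewrite subr_eq0.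
by apply: contraNneq xs => ->.
Qed.

(** Pulling [x] to the front of [t] only reverses the sign of its differences with the entries
    before it, which squaring removes. *)
Lemma sqr_vdm_perm (R : comNzRingType) (s t : seq R) :
  perm_eq s t -> vdm s ^+ 2 = vdm t ^+ 2.
Proof.
elim: s t => [|x s IHs] t; first by rewrite perm_sym => /perm_nilP ->.
move=> st; have xt : x \in t by rewrite -(perm_mem st) mem_head.
case/splitPr: xt st => t1 t2.
rewrite perm_sym -(cat1s x t2) perm_catCA /= perm_cons perm_sym => st.
rewrite vdm_cat /= !exprMn (IHs _ st) vdm_cat (perm_big _ st) big_cat /=.
have -> : \prod_(z <- t1) \prod_(y <- x :: t2) (z - y) =
    \prod_(z <- t1) (z - x) * \prod_(z <- t1) \prod_(y <- t2) (z - y).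
  by rewrite -big_split; apply: eq_bigr => z _; rewrite big_cons.
have := sqrr_sign R (size t1).
by rewrite prod_subC !exprMn => ->; ring.
Qed.

Lemma sqr_vdm_ord (R : comNzRingType) (s : seq R) :
  \prod_(i < size s) \prod_(j < size s | (i < j)%N) (s`_i - s`_j) ^+ 2 = vdm s ^+ 2.
Proof.
elim: s => [|x s IHs] /=; first by rewrite big_ord0 expr1n.
rewrite big_ord_recl /= exprMn; congr (_ * _).
  rewrite big_mkcond big_ord_recl /= mul1r -prodrXl.
  by rewrite (big_nth 0) big_mkord.
rewrite -IHs; apply: eq_bigr => i _.
by rewrite big_mkcond big_ord_recl /= mul1r [RHS]big_mkcond.
Qed.

(** A cycle of length d has sign (-1)^(d - 1); these exponents add up to the degree minus the number
    of parts, the exponent in Stickelberger's theorem. *)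
Lemma sumn_predn la : all (fun d => 0 < d)%N la ->
  sumn (map predn la) = (sumn la - size la)%N.
Proof.
elim: la => //= d la IHla /andP[d_gt0 pla]; rewrite IHla //.
have : (size la <= sumn la)%N.
  by elim: la pla {IHla} => //= ? ? IH /andP[? /IH]; lia.
by lia.
Qed.

(** * Stickelberger's theorem *)

Section Stickelberger.
Variable F : finFieldType.
Local Notation iota := (F_to_Fbar F).
Local Notation "f ^iota" := (map_poly iota f) (at level 2, format "f ^iota").

(* Frobenius rotates each orbit cyclically, which gives the sign by vdm_rot1,
   and permutes the cross terms between distinct orbits. *)
Lemma frob_vdm_orbits (s : seq {poly F}) :
    (forall g, g \in s -> monic_irreducible g) ->
  let L := flatten [seq orbit_bar g | g <- s] in
  perm_eq (map frob L) L /\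
  frob (vdm L) = (-1) ^+ sumn [seq (size g).-2 | g : {poly F} <- s] * vdm L.
Proof.
elim: s => [|g s IHs] irr /=; first by rewrite rmorph1 mul1r.
have [|permL frobL] := IHs.
  by move=> h hs; apply: (irr h); rewrite inE hs orbT.
have [/andP[/eqP fx _] _] := orbit_barP (irr g (mem_head _ _)).
have mapO := map_frob_orbit fx; rewrite -/(orbit_bar g) in mapO.
have permO : perm_eq (map frob (orbit_bar g)) (orbit_bar g).
  by rewrite mapO perm_rot.
split; first by rewrite map_cat perm_cat.
set O := orbit_bar g in mapO permO *; set L := flatten _ in permL frobL *.
have frobO : frob (vdm O) = (-1) ^+ (size g).-2 * vdm O.
  by rewrite (rmorph_vdm (frob : {rmorphism _ -> _})) /= mapO vdm_rot1 size_traject.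
rewrite vdm_cat !rmorphM /= frobL frobO exprD.
have -> : frob (\prod_(x <- O) \prod_(y <- L) (x - y)) =
    \prod_(x <- O) \prod_(y <- L) (x - y).
  rewrite rmorph_prod -[RHS](perm_big _ permO) big_map; apply: eq_bigr => x _ /=.
  rewrite rmorph_prod -[RHS](perm_big _ permL) big_map; apply: eq_bigr => y _ /=.
  exact: rmorphB.
by ring.
Qed.

Lemma roots_bar_perm (s : seq {poly F}) :
    (forall g, g \in s -> monic_irreducible g) ->
  perm_eq (roots_bar (\prod_(g <- s) g)) (flatten [seq orbit_bar g | g <- s]).
Proof.
move=> irr; apply: prod_XsubC_eq; rewrite -roots_bar_monic.
  rewrite rmorph_prod big_flatten big_map big_seq [RHS]big_seq.
  by apply: eq_bigr => g /irr/orbit_barP[].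
by rewrite big_seq monic_prod // => g /irr[].
Qed.

Lemma two_neq0 : odd #|F| -> 2%:R != 0 :> F.
Proof.
move=> oddF; apply/negP=> two0.
have ch2 : 2%N \in [pchar F] by apply/andP.
have := pchar_nat_card F; rewrite (eq_pnat _ (pcharf_eq ch2)) => /p_natP[[|k] qE].
  by have := finNzRing_gt1 F; rewrite qE.
by rewrite qE expnS oddM in oddF.
Qed.

(** The Vandermonde product d of the roots is a square root of the discriminant, and Frobenius
    multiplies it by the sign in the conclusion. So d lies in [F], making the discriminant a square
    there, exactly when that sign is 1. *)
Lemma disc_of_type (la : seq nat) (f : {poly F}) :
    odd #|F| -> all (fun d => 0 < d)%N la -> has_fact_type la f ->
  disc f != 0 /\ chi (disc f) = (-1) ^+ (sumn la - size la).
Proof.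
move=> oddF pla [s [us sm si sla fE]].
have irr g : g \in s -> monic_irreducible g.
  by move=> gs; split; [apply: sm|apply: si].
set d := vdm (flatten [seq orbit_bar g | g <- s]).
have d0 : d != 0 by rewrite vdm_neq0 // uniq_flatten_orbit_bar.
have fm : f \is monic by rewrite fE big_seq monic_prod.
have dbar : disc_bar f = d ^+ 2.
  rewrite /disc_bar (eqP fm) rmorph1 expr1n mul1r sqr_vdm_ord.
  by apply: sqr_vdm_perm; rewrite fE roots_bar_perm.
have [_] := frob_vdm_orbits irr; rewrite -/d.
have -> : sumn [seq (size g).-2 | g : {poly F} <- s] = (sumn la - size la)%N.
  by rewrite -sumn_predn // -sla -map_comp.
move: (sumn la - size la)%N => e frobd.
have [c cE] : exists c, d ^+ 2 = iota c.
  by apply: frob_fixedP; rewrite rmorphXn /= frobd exprMn sqrr_sign mul1r.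
have discE : disc f = c.
  rewrite /disc; case: pickP => [c' /eqP|/(_ c)]; rewrite dbar cE ?eqxx //.
  by move/fmorph_inj.
have c0 : c != 0 by rewrite -(fmorph_eq0 iota) -cE expf_eq0.
rewrite discE; split=> //; rewrite /chi (negPf c0) -signr_odd.
move: frobd; rewrite -signr_odd; case: (odd e) => /= [|]; rewrite ?expr1 ?expr0.
  (* Odd exponent: a square root in [F] would be d or -d, so Frobenius would fix d while negating
     it, impossible as d and 2 are nonzero. *)
  rewrite mulN1r => frobd; case: existsP => // [[x /eqP xc]].
  have : iota x ^+ 2 == d ^+ 2 by rewrite cE -rmorphXn xc.
  have frobN : frob d = d -> False.
    rewrite frobd => /eqP; rewrite eq_sym -addr_eq0 -mulr2n -mulr_natl mulf_eq0.
    by rewrite (negPf d0) orbF -(rmorph_nat iota) fmorph_eq0 (negPf (two_neq0 oddF)).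
  rewrite eqf_sqr => /orP[/eqP xd|/eqP xd]; case: frobN.
    by rewrite -xd frob_iota.
  by rewrite -[d]opprK -xd rmorphN /= frob_iota.
rewrite mul1r => /frob_fixedP[x dx]; case: existsP => // [[]]; exists x.
by apply/eqP/(fmorph_inj iota); rewrite rmorphXn -dx.
Qed.

(** * Sizes of the two classes of the quadratic character *)

Lemma card_squares : odd #|F| ->
  (2 * #|[set c : F | (c != 0%R) && (chi c == 1%R)]| = #|F|.-1)%N.
Proof.
move=> oddF; set C := [set c | _].
have -> : #|F|.-1 = #|[set x : F | x != 0]|.
  by rewrite -(cardsC1 (0 : F)); apply: eq_card => x; rewrite !inE.
(* The fibres of squaring on the nonzero elements are the pairs {x, -x}. *)
rewrite -[RHS]sum1_card (partition_big (fun x => x ^+ 2) (mem C)) /=; last first.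
  move=> x; rewrite !inE /chi expf_eq0 /= => x0; rewrite (negPf x0).
  by rewrite (_ : [exists _, _]) //; apply/existsP; exists x.
rewrite (eq_bigr (fun=> 2%N)); first by rewrite sum_nat_const mulnC.
move=> c.
rewrite inE /chi => /andP[c0]; rewrite (negPf c0); case: existsP => // [[x /eqP xc] _].
have x0 : x != 0 by apply: contraNneq c0 => x0; rewrite -xc x0 expr0n.
rewrite sum1dep_card -[RHS](_ : #|[set x; - x]| = 2%N); last first.
  rewrite cards2 -addr_eq0 -mulr2n -mulr_natl mulf_eq0 (negPf (two_neq0 oddF)).
  by rewrite (negPf x0).
apply: eq_card => y; rewrite !inE -xc eqf_sqr.
by apply/andb_idl => /orP[] /eqP ->; rewrite ?oppr_eq0.
Qed.

Lemma dvdn_card_chi (p e : nat) : odd #|F| -> prime p -> p != 2%N ->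
  (p %| #|F|.-1)%N -> (p %| #|[set c : F | (c != 0%R) && (chi c == (-1) ^+ e)]|)%N.
Proof.
move=> oddF p_pr p2 pq; have sq := card_squares oddF.
set C := [set c | _] in sq.
have pC : (p %| #|C|)%N.
  by move: pq; rewrite -sq Euclid_dvdM // dvdn_prime2 // (negPf p2).
rewrite -signr_odd; case: (odd e); last by rewrite expr0.
(* The non-squares complement the squares among the q - 1 nonzero elements, and p divides both of
   these numbers. *)
set D := [set c | _]; rewrite -(dvdn_addr _ pC) (_ : #|C| + #|D| = #|F|.-1)%N //.
have <- : #|[set~ (0 : F)]| = #|F|.-1 by rewrite cardsC1.
rewrite -cardsUI (_ : C :&: D = set0) ?cards0 ?addn0; last first.
  by apply/setP=> c; rewrite !inE /chi; case: eqP => //=; case: ifP.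
apply: eq_card => c; rewrite !inE -andb_orr /chi.
by case: eqP => //=; case: ifP.
Qed.

End Stickelberger.

(** * Binary expansions with strictly decreasing exponents *)

Lemma binary_expansion j u : (u < 2 ^ j)%N ->
  exists s : seq nat, path gtn j s /\ sumn [seq (2 ^ i)%N | i <- s] = u.
Proof.
elim: j u => [|j IHj] u; first by rewrite expn0 ltnS leqn0 => /eqP ->; exists [::].
have [lt_u|le_u] := ltnP u (2 ^ j).
  move=> _; have [s [ps us]] := IHj u lt_u; exists s; split=> //.
  by case: s ps {us} => //= i s /andP[lt_ij ->]; rewrite andbT ltnW.
rewrite expnS => lt_u; have [|s [ps us]] := IHj (u - 2 ^ j)%N; first by lia.
by exists (j :: s); rewrite /= ltnSn ps us subnKC.
Qed.

(** * Divisibility forced by equidistributed discriminants *)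

Section EquidistributedDiscriminants.
Variable F : finFieldType.

Lemma size_prod_monic (s : seq {poly F}) : {in s, forall g, g \is monic} ->
  size (\prod_(g <- s) g) = (sumn [seq (size g).-1 | g : {poly F} <- s]).+1.
Proof.
elim: s => [|g s IHs] sm; first by rewrite big_nil size_poly1.
have gm := sm g (mem_head _ _).
have sm' : {in s, forall h, h \is monic}.
  by move=> h hs; apply: sm; rewrite inE hs orbT.
have g_gt0 : (0 < size g)%N by rewrite size_poly_gt0 monic_neq0.
rewrite big_cons size_monicM ?IHs //.
  by rewrite /= -{1}(prednK g_gt0) addSn addnS.
by rewrite big_seq monic_neq0 ?monic_prod.
Qed.

Lemma card_of_type m la : uniq la -> sumn la = m ->
  #|[set t : m.-tuple F | `[< has_fact_type la (monic_of t) >]]| =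
  (\prod_(d <- la) size (Irr F d))%N.
Proof.
move=> ula sla; rewrite -size_polys_of_type cardsE cardE -(size_map (@monic_of F m)).
apply: perm_size; apply: uniq_perm.
- by rewrite map_inj_uniq ?enum_uniq //; apply: monic_of_inj.
- exact: uniq_polys_of_type.
move=> f; apply/mapP/idP => [[t]|].
  by rewrite mem_enum => /asboolP/(polys_of_typeP _ ula) tla ->.
move=> /(polys_of_typeP _ ula) fla; have [s [_ sm _ sE fE]] := fla.
have [||t tf] := @monic_of_surj F m f.
- by rewrite fE big_seq monic_prod.
- by rewrite fE size_prod_monic // sE sla.
by exists t => //; rewrite mem_enum; apply/asboolP; rewrite /= tf.
Qed.

(** All discriminants fall in the class C, over which the fibres have equal size. So the number of
    polynomials is a multiple of the size of C, hence of p; as it is also the product of the counts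
    by degree, p divides one of them. *)
Lemma prime_dvd_equidistributed (p m : nat) (la : seq nat) :
    odd #|F| -> prime p -> p != 2%N -> (p %| #|F|.-1)%N ->
    uniq la -> all (fun d => 0 < d)%N la -> sumn la = m ->
    (forall c1 c2 : F,
       c1 != 0 -> chi c1 = (-1) ^+ (m - size la) ->
       c2 != 0 -> chi c2 = (-1) ^+ (m - size la) ->
       count_disc m la c1 = count_disc m la c2) ->
  exists2 d, d \in la & (p %| size (Irr F d))%N.
Proof.
move=> oddF p_pr p2 pq ula pla sla equi.
set C := [set c : F | (c != 0) && (chi c == (-1) ^+ (m - size la))].
have pC : (p %| #|C|)%N by apply: dvdn_card_chi.
suff : (p %| \prod_(d <- la) size (Irr F d))%N.
  elim: la {ula pla sla equi C pC} => [|d la IHla].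
    by rewrite big_nil dvdn1 => /eqP p1; rewrite p1 in p_pr.
  rewrite big_cons Euclid_dvdM // => /orP[pd|/IHla[e ela pe]].
    by exists d; rewrite ?mem_head.
  by exists e; rewrite // inE ela orbT.
rewrite -(card_of_type ula sla) -sum1_card.
rewrite (partition_big (fun t => disc (monic_of t)) (mem C)) /=; last first.
  move=> t; rewrite !inE => /asboolP/(disc_of_type oddF pla)[-> ->].
  by rewrite sla eqxx.
have [c0 c0C|C0] := pickP (mem C); last by rewrite big_pred0 ?dvdn0.
rewrite (eq_bigr (fun=> count_disc m la c0)) ?sum_nat_const ?dvdn_mulr // => c.
move: c0C; rewrite !inE => /andP[c00 /eqP chi0] /andP[cn0 /eqP chic].
rewrite sum1dep_card -(equi c c0) //.
by apply: eq_card => t; rewrite !inE.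
Qed.

End EquidistributedDiscriminants.

(** * The partition that excludes odd primes from the gcd *)

Theorem theorem5p1 (F : finFieldType) (m : nat) :
  odd #|F| ->
  squarefree (#|F|.-1) ->
  (2 <= m)%N ->
  (forall la : seq nat, is_partition m la ->
     forall c1 c2 : F,
       c1 != 0 -> chi c1 = (-1) ^+ (m - size la) ->
       c2 != 0 -> chi c2 = (-1) ^+ (m - size la) ->
       count_disc m la c1 = count_disc m la c2) ->
  gcdn (#|F|.-1) (m * m.-1) = 2%N.
Proof.
move=> oddF sqf m2 equi.
have q_gt1 : (1 < #|F|)%N := finNzRing_gt1 F.
have dv2 : (2 %| gcdn (#|F|.-1) (m * m.-1))%N.
  rewrite dvdn_gcd !dvdn2 oddM; case: m m2 {equi} => //= m _.
  by rewrite andNb -oddS prednK ?oddF // ltnW.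
have [k gE] := dvdnP dv2.
have k_gt0 : (0 < k)%N.
  have : (0 < gcdn #|F|.-1 (m * m.-1))%N.
    by rewrite gcdn_gt0 -ltnS prednK ?q_gt1 // ltnW.
  by rewrite gE muln_gt0 => /andP[].
have [k1|k_gt1] : k = 1%N \/ (1 < k)%N by lia.
  by rewrite gE k1.
have p_pr := pdiv_prime k_gt1; set p := pdiv k in p_pr.
have pk : (p %| k)%N := pdiv_dvd k.
have g_q : (k * 2 %| #|F|.-1)%N by rewrite -gE dvdn_gcdl.
(* If p were 2, then 4 would divide q - 1, against squarefreeness. *)
have p2 : p != 2%N.
  apply/eqP => p2; have := sqf 2%N isT; rewrite (dvdn_trans _ g_q) //.
  by rewrite dvdn_pmul2r // -p2.
have pq : (p %| #|F|.-1)%N by apply: dvdn_trans g_q; rewrite dvdn_mulr.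
have : (p %| m * m.-1)%N.
  by apply: (@dvdn_trans (k * 2)); [rewrite dvdn_mulr|rewrite -gE dvdn_gcdr].
have p_gt2 : (2 < p)%N by rewrite ltn_neqAle eq_sym p2 prime_gt1.
rewrite Euclid_dvdM // => pm.
(* [r] is the remainder of m modulo p written as a list of parts: empty if p divides m, a single 1
   if p divides m - 1. *)
have [u [r [r01 mE]]] : exists u r,
    r \in [:: [::]; [:: 1%N]] /\ m = (p * u + sumn r)%N.
  case/orP: pm => /dvdnP[u uE]; exists u.
    by exists [::]; rewrite !inE eqxx /=; split=> //; lia.
  by exists [:: 1%N]; rewrite !inE eqxx /=; split=> //; lia.
have [s [ps su]] := binary_expansion (ltn_expl u (ltnSn 1)).
pose la := [seq (p * 2 ^ j)%N | j <- s] ++ r.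
(* As the parts p 2^j exceed 1, a final part 1 keeps the list strictly decreasing, hence free of
   repetition. *)
have la_gt1 d : d \in [seq (p * 2 ^ j)%N | j <- s] -> (1 < d)%N.
  by case/mapP=> j _ ->; rewrite (leq_trans (ltnW p_gt2)) // leq_pmulr ?expn_gt0.
have sla : sumn la = m.
  rewrite mE sumn_cat -su; congr (_ + _)%N.
  by elim: (s) => [|j s' IH] /=; rewrite ?muln0 // IH mulnDr.
have sorted_la : sorted gtn la.
  have gtn_tr : transitive gtn by move=> a b c ba cb; apply: ltn_trans cb ba.
  have : sorted gtn [seq (p * 2 ^ j)%N | j <- s].
    apply: (@homo_sorted _ _ _ gtn); last exact: path_sorted ps.
    by move=> a b; rewrite /= ltn_pmul2l ?ltn_exp2l // prime_gt0.
  rewrite /la; move: r01; rewrite !inE => /orP[] /eqP ->; first by rewrite cats0.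
  rewrite cats1; case: [seq _ | _ <- _] la_gt1 => //= d l gt1 pl.
  by rewrite rcons_path pl /=; apply: gt1; rewrite mem_last.
have ula : uniq la.
  apply: sorted_uniq sorted_la; last by move=> x; apply: ltnn.
  by move=> a b c ba cb; apply: ltn_trans cb ba.
have pla : all (fun d => 0 < d)%N la.
  rewrite all_cat; apply/andP; split; first by apply/allP=> d /la_gt1/ltnW.
  by move: r01; rewrite !inE => /orP[] /eqP ->.
have part : is_partition m la.
  rewrite /is_partition pla sla eqxx !andbT.
  by apply: sub_sorted sorted_la => a b; apply: ltnW.
have [d] := prime_dvd_equidistributed oddF p_pr p2 pq ula pla sla (equi la part).
rewrite mem_cat => /orP[/mapP[j _ ->]|].
  by move=> pN; case/negP: (size_Irr_coprime j p_pr p2 pq (sqf p p_pr)).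
move: r01; rewrite !inE => /orP[] /eqP -> //; rewrite inE => /eqP ->.
(* For the part 1 the count is q, and p cannot divide both q and q - 1. *)
rewrite size_Irr1 -[#|F|]prednK 1?ltnW // -addn1 dvdn_addr // dvdn1 => /eqP p1.
by rewrite p1 in p_pr.
Qed.
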